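(* No s-QRNN with a linear threshold decoder can recognize $\{a^nb^n\mid n\in\mathbb{N}\}$; i.e. $\{a^nb^n\mid n\in\mathbb{N}\}\notin D_1(\text{s-QRNN})$. That is, for $\Sigma=\{a,b\}$, there is no s-QRNN over $\Sigma$ (of any window length and dimension $k$) and no $\mathbf w\in\mathbb{Q}^k$, $\beta\in\mathbb{Q}$ such that for all $x\in\Sigma^*$: $\mathbf w\cdot\mathbf h_{|x|}+\beta>0$ if and only if $x\in\{a^nb^n\mid n\in\mathbb{N}\}$, where $\mathbf h_{|x|}$ is the final state of the s-QRNN on $x$.
   Context: $\mathbb{N}=\{0,1,2,\dots\}$. QRNN of window length $w$ and dimension $k$: with an embedding $\Sigma\to\mathbb{Q}^{d_x}$, $x_t\mapsto\mathbf x_t$, and $\mathbf X$ the matrix of input vectors, let $\mathbf z_t,\mathbf f_t,\mathbf i_t,\mathbf o_t\in\mathbb{Q}^k$ be the rows of $\mathbf Z=\tanh(\mathbf W^z*\mathbf X)$, $\mathbf F=\sigma(\mathbf W^f*\mathbf X)$, $\mathbf I=\sigma(\mathbf W^i*\mathbf X)$, $\mathbf O=\sigma(\mathbf W^o*\mathbf X)$, where $*$ is convolution over time with window length $w$, rational weights $\mathbf W^\bullet\in\mathbb{Q}^{d_x\times w\times k}$, and rational biases allowed (so row $t$ is the activation applied to an affine function of $\mathbf x_{t-w+1},\dots,\mathbf x_t$, zero-padded before the start). Then $\mathbf c_0=\mathbf h_0=\mathbf 0$, $\mathbf c_t=\mathbf f_t\odot\mathbf c_{t-1}+\mathbf i_t\odot\mathbf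 z_t$, $\mathbf h_t=\mathbf o_t\odot\mathbf c_t$. Saturation: the s-QRNN is the QRNN in which $\sigma$ is replaced by the step function equal to $1$ on positive and $0$ on negative arguments, and $\tanh$ by the sign function with values in $\{-1,0,1\}$; parameters are such that no argument of a $\sigma$ is exactly $0$ on any input, so all gates lie in $\{0,1\}$. $D_1(E)$ is the set of languages decided by an encoder of type $E$ followed by a linear threshold decoder $\mathbf d_1(\mathbf h)=\mathbb{1}_{>0}(\mathbf w\cdot\mathbf h+\beta)$ applied to the final state. *)

(* Defs.v *)
From mathcomp Require Import all_boot all_order all_algebra.
Set Implicit Arguments.
Unset Strict Implicit.
Unset Printing Implicit Defensive.
Import Order.TTheory GRing.Theory Num.Theory.
Local Open Scope ring_scope.

Definition language (Sigma : Type) := seq Sigma -> Prop.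

(* An encoder is represented by the map sending a word x to its final state
   h_|x|. *)
Definition encoder (Sigma : Type) (k : nat) := seq Sigma -> 'rV[rat]_k.

Definition encoder_class (Sigma : Type) :=
  forall k : nat, encoder Sigma k -> Prop.

Definition d1 (k : nat) (v : 'rV[rat]_k) (beta : rat) (h : 'rV[rat]_k) : bool :=
  0 < (\sum_(m < k) v 0 m * h 0 m) + beta.

Definition D1 (Sigma : Type) (E : encoder_class Sigma) (L : language Sigma) :=
  exists (k : nat) (e : encoder Sigma k),
    E k e /\
    exists (v : 'rV[rat]_k) (beta : rat),
      forall x : seq Sigma, d1 v beta (e x) <-> L x.

Record qrnn (Sigma : Type) (dx w k : nat) := QRNN {
  embed : Sigma -> 'rV[rat]_dx;
  Wz : 'I_dx -> 'I_w -> 'I_k -> rat;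
  Wf : 'I_dx -> 'I_w -> 'I_k -> rat;
  Wi : 'I_dx -> 'I_w -> 'I_k -> rat;
  Wo : 'I_dx -> 'I_w -> 'I_k -> rat;
  bz : 'rV[rat]_k;
  bf : 'rV[rat]_k;
  bi : 'rV[rat]_k;
  bo : 'rV[rat]_k
}.

Section Run.
Variables (Sigma : Type) (dx w k : nat) (q : qrnn Sigma dx w k).
Implicit Types (x : seq Sigma) (t : nat).

(* Time is 1-based: [input x t] is the embedding of the t-th letter of x for
   1 <= t <= |x|, and the padding vector 0 at time 0. *)
Definition input x t : 'rV[rat]_dx := nth 0 (0 :: map (embed q) x) t.

(* Row t of W * X + b.  The j-th vector of the window is the one at time
   t - w + 1 + j; times before the start are truncated to 0, hence padded. *)
Definition preact (W : 'I_dx -> 'I_w -> 'I_k -> rat) (b : 'rV[rat]_k) x t :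
    'rV[rat]_k :=
  \row_(m < k) ((\sum_(i < dx) \sum_(j < w)
                  W i j m * input x (t.+1 + j - w)%N 0 i) + b 0 m).

Definition hadamard (u v : 'rV[rat]_k) : 'rV[rat]_k := map2_mx *%R u v.

Variables sigma tanh : rat -> rat.

Definition Zrow x t := map_mx tanh (preact (Wz q) (bz q) x t).
Definition Frow x t := map_mx sigma (preact (Wf q) (bf q) x t).
Definition Irow x t := map_mx sigma (preact (Wi q) (bi q) x t).
Definition Orow x t := map_mx sigma (preact (Wo q) (bo q) x t).

Fixpoint cell x t : 'rV[rat]_k :=
  if t is s.+1
  then hadamard (Frow x t) (cell x s) + hadamard (Irow x t) (Zrow x t)
  else 0.

Definition hidden x t : 'rV[rat]_k :=
  if t is _.+1 then hadamard (Orow x t) (cell x t) else 0.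

(* No argument of sigma vanishes, on any input. *)
Definition gates_nonzero : Prop :=
  forall x t (m : 'I_k), (1 <= t <= size x)%N ->
    [/\ preact (Wf q) (bf q) x t 0 m != 0,
        preact (Wi q) (bi q) x t 0 m != 0 &
        preact (Wo q) (bo q) x t 0 m != 0].

End Run.

(* The value at 0 is irrelevant under [gates_nonzero]. *)
Definition step (r : rat) : rat := if 0 < r then 1 else 0.

Definition s_qrnn (Sigma : Type) : encoder_class Sigma :=
  fun k e =>
    exists (dx w : nat) (q : qrnn Sigma dx w k),
      gates_nonzero q /\
      forall x : seq Sigma, e x = hidden q step Num.sg x (size x).

Inductive letter := La | Lb.

Definition anbn : language letter :=
  fun x => exists n : nat, x = nseq n La ++ nseq n Lb.

(* Main.v *)
(** After the unbounded repetition of a letter c has filled the window, every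
    gate is constant, say f, so the difference of the cell states reached from
    two prefixes is multiplied by f at each step.  As f * f = f for gates in
    {0,1}, this difference stabilises: hence, with D(n, m) the decoder's value
    on a^n b^m and N larger than the window length,
    D(N+1, N+1) - D(N, N+1) = D(N+1, N) - D(N, N).  Then
    D(N, N) + D(N+1, N+1) = D(N+1, N) + D(N, N+1), whereas the left side should
    be positive and the right side nonpositive. *)

Require Import Defs.
From mathcomp Require Import all_boot all_order all_algebra.
From mathcomp Require Import zify ring lra.
Set Implicit Arguments.
Unset Strict Implicit.
Unset Printing Implicit Defensive.
Import Order.TTheory GRing.Theory Num.Theory.
Local Open Scope ring_scope.

Lemma step_idem (r : rat) : step r * step r = step r.
Proof. by rewrite /step; case: ifP => _; rewrite ?mulr1 ?mulr0. Qed.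

Section Window.
Variables (Sigma : Type) (dx w k : nat) (q : qrnn Sigma dx w k).
Implicit Types (p s x y : seq Sigma) (c : Sigma).

Lemma input_catl x y t : (t <= size x)%N -> input q (x ++ y) t = input q x t.
Proof.
case: t => [|t] ltx //.
by rewrite /input map_cat /= nth_cat size_map ltx.
Qed.

(** At [t = 0] the right side would be padding, the left the last letter of [p]. *)
Lemma input_catr p s t : (0 < t)%N -> input q (p ++ s) (size p + t) = input q s t.
Proof.
case: t => [|t] // _.
by rewrite /input map_cat addnS /= nth_cat size_map ltnNge leq_addr /= addKn.
Qed.

Lemma preact_catl W b x y t :
  (t <= size x)%N -> preact q W b (x ++ y) t = preact q W b x t.
Proof.
move=> ltx; apply/rowP => m; rewrite !mxE; congr (_ + _).
apply: eq_bigr => i _; apply: eq_bigr => j _; rewrite input_catl //.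
by have := ltn_ord j; lia.
Qed.

(** Every time read on [s] is at least [size s + 1 - w >= 1], so the window stays inside [s] and
    meets no padding. *)
Lemma preact_suffix W b p s : (w <= size s)%N ->
  preact q W b (p ++ s) (size (p ++ s)) = preact q W b s (size s).
Proof.
move=> lews; apply/rowP => m; rewrite !mxE; congr (_ + _).
apply: eq_bigr => i _; apply: eq_bigr => j _.
rewrite -[in RHS](input_catr p); last by lia.
by congr (_ * input _ _ _ _ _); rewrite size_cat; lia.
Qed.

Variables sigma tanh : rat -> rat.

Lemma cell_catl x y t :
  (t <= size x)%N -> cell q sigma tanh (x ++ y) t = cell q sigma tanh x t.
Proof.
elim: t => [|t IHt] // ltx.
by rewrite /= /Frow /Irow /Zrow !preact_catl // IHt // ltnW.
Qed.

Definition final_cell x := cell q sigma tanh x (size x).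

(** The last update is an affine map with coefficients depending on [x] only, hence common to all
    prefixes [p]. *)
Lemma final_cell_rcons p s c (x := rcons s c) : (w <= size x)%N ->
  final_cell (p ++ x) =
    hadamard (Frow q sigma x (size x)) (final_cell (p ++ s)) +
    hadamard (Irow q sigma x (size x)) (Zrow q tanh x (size x)).
Proof.
move=> lewx; rewrite /final_cell.
have {1}-> : size (p ++ x) = (size (p ++ s)).+1.
  by rewrite /x -rcons_cat size_rcons.
rewrite /= /Frow /Irow /Zrow.
have <- : size (p ++ x) = (size (p ++ s)).+1.
  by rewrite /x -rcons_cat size_rcons.
rewrite !preact_suffix //; congr (hadamard _ _ + _).
by rewrite /x -cats1 catA cell_catl.
Qed.

Lemma hidden_suffix p s : (w <= size s)%N -> (0 < size s)%N ->
  hidden q sigma tanh (p ++ s) (size (p ++ s)) =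
    hadamard (Orow q sigma s (size s)) (final_cell (p ++ s)).
Proof.
move=> lews s_gt0; rewrite /hidden /final_cell /Orow -(preact_suffix _ _ p lews).
by case: (size (p ++ s)) (size_cat p s) => [|n] //; lia.
Qed.

End Window.

Lemma hidden_diff_stable (Sigma : Type) (dx w k : nat) (q : qrnn Sigma dx w k)
    (tanh : rat -> rat) (p1 p2 : seq Sigma) (c : Sigma) (n : nat) (m : 'I_k)
    (h := fun x : seq Sigma => hidden q step tanh x (size x) 0 m) :
  (w <= n.+1)%N ->
  h (p1 ++ nseq n.+2 c) - h (p2 ++ nseq n.+2 c) =
  h (p1 ++ nseq n.+1 c) - h (p2 ++ nseq n.+1 c).
Proof.
move=> lewn; set s := nseq n.+1 c.
have sz_s : size s = n.+1 by rewrite size_nseq.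
have s_rcons : s = rcons (nseq n c) c by rewrite /s -addn1 nseqD cats1.
(* One [c] moves into the prefix, so that all four words end in [s] and share the output gate. *)
have cS p : p ++ nseq n.+2 c = (rcons p c) ++ s by rewrite cat_rcons.
have cSn p : rcons p c ++ nseq n c = p ++ s by rewrite cat_rcons.
rewrite /h !cS !hidden_suffix ?sz_s //.
have lews : (w <= size (rcons (nseq n c) c))%N by rewrite -s_rcons sz_s.
have E p := @final_cell_rcons _ _ _ _ q step tanh p (nseq n c) c lews.
(* The longer words are unrolled twice, the shorter ones once, down to the cells of [p ++ nseq n c];
   in the differences this leaves [f * f] against [f]. *)
rewrite -s_rcons in E; rewrite !(E (rcons _ _)) !cSn !E !mxE.
set f := step (\sum_(i < dx) _ + bf q 0 m).
have ff : f * f = f by exact: step_idem.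
by ring: ff.
Qed.

Lemma anbn_nseq (n m : nat) : anbn (nseq n La ++ nseq m Lb) <-> n = m.
Proof.
split=> [[l E]|->]; last by exists m.
pose isa x := if x is La then true else false.
(* Counting [La] gives [n = l]; the lengths give [n + m = l + l]. *)
have := congr1 (count isa) E; have := congr1 size E.
by rewrite !size_cat !count_cat !size_nseq !count_nseq /=; lia.
Qed.

Theorem theorem9 : ~ D1 (@s_qrnn letter) anbn.
Proof.
move=> [k [e [[dx [w [q [_ eE]]]] [v [beta dP]]]]].
pose D n m := \sum_(i < k) v 0 i * e (nseq n La ++ nseq m Lb) 0 i + beta.
have DP n m : (0 < D n m) <-> n = m.
  by rewrite -anbn_nseq; exact: dP.
have Dmix : D w.+2 w.+2 - D w.+1 w.+2 = D w.+2 w.+1 - D w.+1 w.+1.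
  have addKB (a b : rat) : a + beta - (b + beta) = a - b by ring.
  rewrite /D !addKB -!sumrB.
  apply: eq_bigr => i _; rewrite -!mulrBr !eE; congr (_ * _).
  (* The prefixes are [w.+2] and [w.+1] letters [La], with [c = Lb] and [n = w]. *)
  exact: hidden_diff_stable.
have D11 := (DP w.+1 w.+1).2 erefl; have D22 := (DP w.+2 w.+2).2 erefl.
have D12 : D w.+1 w.+2 <= 0 by rewrite leNgt; apply/negP => /DP; lia.
have D21 : D w.+2 w.+1 <= 0 by rewrite leNgt; apply/negP => /DP; lia.
by lra.
Qed.
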